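(* Let $P$ be a finite poset with $n=|P|$ elements having a minimum $\hat0$ and a maximum $\hat1$, and fix an order ideal $I$ of $P$ with $I\ne\emptyset$ and $I\ne P$. Then there is a bijection $\Phi:\{(p,L)\mid L\in\mathcal{L}(P),\ p\in{\sf des}_I(L)\}\to\mathcal{L}(P)$ such that for every $(p,L)$ in the domain, $\Phi(p,L)$ lies in the same $\langle\tau_o,\tau_e\rangle$-orbit as $L$. In particular, the statistic $L\mapsto|{\sf des}_I(L)|$ is homomesic with respect to the action of $\langle\tau_o,\tau_e\rangle$ on $\mathcal{L}(P)$, with average value $1$ on every orbit.
   Context: $\mathcal{L}(P)$ is the set of linear extensions of $P$, i.e. bijections $L:P\to\{1,\ldots,n\}$ with $L(p)<L(q)$ whenever $p<q$. An order ideal is a subset $I\subseteq P$ closed downward. For $L\in\mathcal{L}(P)$, ${\sf des}_I(L)$ is the set of $p\in I$ with $L(p)<n$ such that $q=L^{-1}(L(p)+1)$ satisfies $q\notin I$ and $q$ covers $p$ ($p\lessdot q$). For $1\le i<n$, $\tau_i$ acts on $\mathcal{L}(P)$ by interchanging the labels $i$ and $i+1$ of $L$ if the result is a linear extension, and fixing $L$ otherwise; $\tau_o=\prod_{i\text{ odd}}\tau_i$ and $\tau_e=\prod_{i\text{ even}}\tau_i$ (factors in each product commute). A statistic is homomesic with respect to a group action if its average over each orbit is the same constant. *)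

(* Defs.v *)
From HB Require Import structures.
From mathcomp Require Import all_boot all_order all_algebra all_fingroup.
From mathcomp Require Import zify.

Set Implicit Arguments.
Unset Strict Implicit.
Unset Printing Implicit Defensive.

Import Order.TTheory GRing.Theory.

Section LinearExtensions.

Context {d : Order.disp_t} (P : finPOrderType d).
Implicit Types (p q r : P) (I : {set P}).

Definition covers p q : bool :=
  (p < q)%O && ~~ [exists r, (p < r)%O && (r < q)%O].

Definition order_ideal I : Prop :=
  forall p q, (p <= q)%O -> q \in I -> p \in I.

(* Values lie in {0, .., n-1}, with n = #|P|; the labels in {1, .., n} are
   given by [label] below. *)
Definition is_linext (L : {ffun P -> 'I_#|P|}) : bool :=
  injectiveb L && [forall p, forall q, (p < q)%O ==> (L p < L q)%N].

Record linext : predArgType :=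
  LinExt { linext_val :> {ffun P -> 'I_#|P|}; _ : is_linext linext_val }.

HB.instance Definition _ := [isSub for linext_val].
HB.instance Definition _ := [Finite of linext by <:].

Lemma linext_bij (L : linext) : bijective L.
Proof.
have /andP[/injectiveP Linj _] := valP L.
by apply: inj_card_bij; rewrite ?card_ord.
Qed.

Definition label (L : {ffun P -> 'I_#|P|}) p : nat := (L p).+1.

Definition swap_nat (i k : nat) : nat :=
  if k == i then i.+1 else if k == i.+1 then i else k.

(* The default [L p] of [insubd] is not used when 1 <= i < n; for other i,
   [swap_labels i] is the identity. *)
Definition swap_labels (i : nat) (L : {ffun P -> 'I_#|P|}) :
    {ffun P -> 'I_#|P|} :=
  [ffun p => insubd (L p) (swap_nat i (label L p)).-1].

Lemma swap_nat_in n i k : (0 < i < n)%N -> (k < n)%N ->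
  (if (swap_nat i k.+1).-1 < n then (swap_nat i k.+1).-1 else k)%N.+1 =
  swap_nat i k.+1.
Proof.
by rewrite /swap_nat; case: eqP => ?; [|case: eqP => ?]; case: ifP => ?; lia.
Qed.

Lemma swap_nat_out n i k : ~~ (0 < i < n)%N -> (k < n)%N ->
  (if (swap_nat i k.+1).-1 < n then (swap_nat i k.+1).-1 else k)%N = k.
Proof.
by rewrite /swap_nat; case: eqP => ?; [|case: eqP => ?]; case: ifP => ?; lia.
Qed.

Lemma label_swap_labels i L p : (0 < i < #|P|)%N ->
  label (swap_labels i L) p = swap_nat i (label L p).
Proof.
by move=> iP; rewrite {1}/label ffunE val_insubd; apply: swap_nat_in.
Qed.

Lemma swap_labels_id i L : ~~ (0 < i < #|P|)%N -> swap_labels i L = L.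
Proof.
move=> iP; apply/ffunP => p; apply/val_inj.
by rewrite ffunE val_insubd; apply: swap_nat_out.
Qed.

Lemma swap_natK i : involutive (swap_nat i).
Proof.
move=> k; rewrite /swap_nat; have [->|ki] := eqVneq k i.
  by rewrite eqxx (gtn_eqF (ltnSn i)).
have [->|ki1] := eqVneq k i.+1; first by rewrite eqxx.
by rewrite (negPf ki) (negPf ki1).
Qed.

Lemma swap_labelsK i : involutive (swap_labels i).
Proof.
move=> L; have [iP|iP] := boolP (0 < i < #|P|)%N; last first.
  by rewrite !swap_labels_id.
apply/ffunP => p; apply/val_inj/succn_inj.
by rewrite -/(label _ p) !label_swap_labels // swap_natK.
Qed.

Definition tau_fun (i : nat) (L : linext) : linext :=
  insubd L (swap_labels i L).

Lemma tau_funK i : involutive (tau_fun i).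
Proof.
move=> L; rewrite {2}/tau_fun /insubd.
case: insubP => [L' swL L'E | swL] /=; apply/val_inj; rewrite val_insubd.
  by rewrite [linext_val L']L'E swap_labelsK (valP L).
by rewrite (negPf swL).
Qed.

Definition tau (i : nat) : {perm linext} := perm (can_inj (tau_funK i)).

(* The factors of each product commute, so the order is immaterial. *)
Definition tau_odd : {perm linext} :=
  (\prod_(1 <= i < #|P| | odd i) tau i)%g.

Definition tau_even : {perm linext} :=
  (\prod_(1 <= i < #|P| | ~~ odd i) tau i)%g.

Definition tau_group : {group {perm linext}} :=
  <<[set tau_odd; tau_even]>>%G.

(* The q with label L(p) + 1 exists exactly when L(p) < n, and is unique. *)
Definition des I (L : linext) : {set P} :=
  [set p in I | [exists q, [&& label L q == (label L p).+1,
                               q \notin I & covers p q]]].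

End LinearExtensions.

Definition homomesic (aT : finGroupType) (T : finType)
    (to : {action aT &-> T}) (G : {group aT}) (f : T -> rat) (c : rat) : Prop :=
  forall x : T,
    ((\sum_(y in orbit to G x) f y) / #|orbit to G x|%:R)%R = c.

(* Main.v *)
(** Write [p_1, ..., p_n] for the elements in the order given by [L] and [x_i]
    for the indicator of [p_i \in I].  Since [I] is an ideal containing the
    minimum but not the maximum, the sum of [x_i - x_(i+1)] telescopes to [1],
    and the indices with [p_i < p_(i+1)] contribute exactly [#|des I L|].  For
    the other indices [tau i] swaps [p_i] and [p_(i+1)] and so negates
    [x_i - x_(i+1)], while the other factors of [tau_odd] or [tau_even] do not
    touch it.  Hence these contributions cancel over each orbit.  The bijection
    exists because both sides have the same number of elements over each
    orbit. *)
Require Import Defs.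
From mathcomp Require Import all_boot all_order all_algebra all_fingroup.
From mathcomp Require Import zify.

Set Implicit Arguments.
Unset Strict Implicit.
Unset Printing Implicit Defensive.

Import Order.TTheory GRing.Theory Num.Theory.

(** The fibres of [f] and [g] over each [c] are enumerated, and the k-th element of one is sent to
    the k-th element of the other. *)
Lemma fiber_bijection (A B C : finType) (f : A -> C) (g : B -> C) :
    (forall c, #|[pred a | f a == c]| = #|[pred b | g b == c]|) ->
  exists Phi : A -> B, bijective Phi /\ forall a, g (Phi a) = f a.
Proof.
move=> card_fg.
have cardAB : #|A| = #|B|.
  rewrite -[LHS]sum1_card -[RHS]sum1_card (partition_big f xpredT) //=.
  rewrite [RHS](partition_big g xpredT) //=.
  by apply: eq_bigr => c _; rewrite !sum1_card; apply: card_fg.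
(* [nth] needs a default [b0]; if [B] is empty, so is [A]. *)
case: (pickP (@predT B)) => [b0 _ | B0]; last first.
  have A0 (a : A) : False.
    by have := cardAB; rewrite (eq_card0 B0) => /card0_eq/(_ a).
  exists (fun a => False_rect B (A0 a)); split=> [|a]; last by case: (A0 a).
  by apply: inj_card_bij; rewrite ?cardAB // => a; case: (A0 a).
pose EA c := enum [pred a | f a == c]; pose EB c := enum [pred b | g b == c].
have idx a : index a (EA (f a)) < size (EA (f a)).
  by rewrite index_mem mem_enum inE.
have sizeE c : size (EA c) = size (EB c) by rewrite -!cardE card_fg.
pose Phi a := nth b0 (EB (f a)) (index a (EA (f a))).
have gPhi a : g (Phi a) = f a.
  apply/eqP; have : Phi a \in EB (f a) by rewrite mem_nth // -sizeE.
  by rewrite /EB mem_enum inE.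
exists Phi; split=> //; apply: inj_card_bij; last by rewrite cardAB.
move=> a a' eqPhi; have eqf : f a = f a' by rewrite -!gPhi eqPhi.
move: eqPhi; rewrite /Phi eqf => /eqP; rewrite nth_uniq ?enum_uniq -?sizeE //.
  by move/eqP/(index_inj a); apply; rewrite /EA mem_enum inE ?eqf.
by rewrite -eqf.
Qed.

(** * Transposing two consecutive labels *)

Lemma swap_natl i : swap_nat i i = i.+1.
Proof. by rewrite /swap_nat eqxx. Qed.

Lemma swap_natr i : swap_nat i i.+1 = i.
Proof. by rewrite -{1}(swap_natl i) swap_natK. Qed.

Lemma swap_nat_id i k : k != i -> k != i.+1 -> swap_nat i k = k.
Proof. by rewrite /swap_nat => /negPf -> /negPf ->. Qed.

Lemma swap_nat_range n i k :
  0 < i < n -> 0 < k <= n -> 0 < swap_nat i k <= n.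
Proof.
rewrite /swap_nat; have [->|] := eqVneq k i; first by lia.
by have [->|] := eqVneq k i.+1; lia.
Qed.

Lemma ltn_swap_nat i j k :
  j < k -> ~~ ((j == i) && (k == i.+1)) -> swap_nat i j < swap_nat i k.
Proof.
rewrite /swap_nat; case: (eqVneq j i) => ?; case: (eqVneq k i) => ?;
by case: (eqVneq j i.+1) => ?; case: (eqVneq k i.+1) => ?; lia.
Qed.

(** * Linear extensions read by position *)

Section Gyration.

Context {d : Order.disp_t} {P : finTBPOrderType d}.
Implicit Types (p q : P) (L : linext P) (I : {set P}) (i j k : nat).

Lemma label_inj L : injective (label L).
Proof.
by move=> p q [] /val_inj; apply: bij_inj (linext_bij L) p q.
Qed.

Lemma ltn_label L p q : (p < q)%O -> (label L p < label L q)%N.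
Proof. by have /andP[_ /forallP/(_ p)/forallP/(_ q)/implyP] := valP L. Qed.

Lemma label_bounds L p : (0 < label L p <= #|P|)%N.
Proof. by rewrite /= ltn_ord. Qed.

(* The element with label [k], and [\bot] for [k] outside [1, #|P|]. *)
Definition elt L k : P := odflt \bot%O [pick p | label L p == k].

Lemma labelK L : cancel (label L) (elt L).
Proof.
move=> p; rewrite /elt; case: pickP => [q /eqP/label_inj //|/(_ p)].
by rewrite eqxx.
Qed.

Lemma eltK L k : (0 < k <= #|P|)%N -> label L (elt L k) = k.
Proof.
case: k => // k /= k_lt; have [g Lg gL] := linext_bij L.
have := labelK L (g (Ordinal k_lt)); rewrite /label gL /= => ->.
by rewrite gL.
Qed.

Lemma elt1 L : elt L 1 = \bot%O.
Proof.
have [//|n0] := eqVneq (elt L 1) \bot%O.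
have P_gt0 : (0 < #|P|)%N by apply/card_gt0P; exists \bot%O.
have : (\bot < elt L 1)%O by rewrite lt0x.
by move/(ltn_label L); rewrite eltK.
Qed.

Lemma elt_card L : elt L #|P| = \top%O.
Proof.
have [//|n0] := eqVneq (elt L #|P|) \top%O.
have P_gt0 : (0 < #|P|)%N by apply/card_gt0P; exists \bot%O.
have : (elt L #|P| < \top)%O by rewrite ltx1.
move/(ltn_label L); rewrite eltK ?P_gt0 ?leqnn // => /leq_trans/(_ (ltn_ord _)).
by rewrite ltnn.
Qed.

(** An element strictly between [p] and [q] would have a label strictly between two consecutive
    integers. *)
Lemma covers_label L p q :
  label L q = (label L p).+1 -> covers p q = (p < q)%O.
Proof.
move=> Lq; rewrite /covers; case: (p < q)%O => //=; apply/existsP => -[r].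
by case/andP=> /(ltn_label L) + /(ltn_label L); rewrite Lq; lia.
Qed.

(** Exchanging the labels [i] and [i.+1] reverses the relative order of no other pair, so no other
    relation can break. *)
Lemma is_linext_swap L i : (0 < i < #|P|)%N ->
  is_linext (swap_labels i L) = ~~ (elt L i < elt L i.+1)%O.
Proof.
move=> iP; apply/idP/idP => [/andP[_ lin]|ninc].
  apply/negP => lti; move/forallP/(_ (elt L i))/forallP/(_ (elt L i.+1)): lin.
  rewrite lti /= -ltnS -!/(label _ _) !label_swap_labels //.
  by rewrite !eltK ?swap_natl ?swap_natr; lia.
apply/andP; split.
  apply/injectiveP => p q /(congr1 val)/(congr1 succn).
  rewrite -!/(label _ _) !label_swap_labels //.
  by move/(can_inj (swap_natK i))/label_inj.
apply/forallP => p; apply/forallP => q; apply/implyP => ltpq.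
rewrite -ltnS -!/(label _ _) !label_swap_labels //.
apply: ltn_swap_nat; first exact: ltn_label.
by apply: contra ninc => /andP[/eqP <- /eqP <-]; rewrite !labelK.
Qed.

Lemma tau_id L i :
  (0 < i < #|P|)%N -> (elt L i < elt L i.+1)%O -> tau P i L = L.
Proof.
move=> iP lti; rewrite permE; apply/val_inj.
by rewrite val_insubd is_linext_swap // lti.
Qed.

Lemma elt_tau L i k : (0 < i < #|P|)%N -> ~~ (elt L i < elt L i.+1)%O ->
  (0 < k <= #|P|)%N -> elt (tau P i L) k = elt L (swap_nat i k).
Proof.
move=> iP ninc kP; apply: (@label_inj (tau P i L)); rewrite eltK //.
have -> : linext_val (tau P i L) = swap_labels i L.
  rewrite permE; have := val_insubd L (swap_labels i L).
  by rewrite is_linext_swap // ninc.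
by rewrite label_swap_labels // eltK ?swap_natK // swap_nat_range.
Qed.

(** * Sign changes under the toggles *)

Local Open Scope ring_scope.

Definition drop I L i : int :=
  (elt L i \in I)%:R - (elt L i.+1 \in I)%:R.

(** Where the two elements are comparable, [tau i] fixes [L] and could not negate the drop; the
    value 0 there makes the sign rule hold for every [L]. *)
Definition free_drop I L i : int :=
  if (elt L i < elt L i.+1)%O then 0 else drop I L i.

Lemma free_drop_tau I L i : (0 < i < #|P|)%N ->
  free_drop I (tau P i L) i = - free_drop I L i.
Proof.
move=> iP; have [lti|ninc] := boolP (elt L i < elt L i.+1)%O.
  by rewrite tau_id // /free_drop lti oppr0.
rewrite /free_drop /drop !elt_tau //; try by lia.
rewrite swap_natl swap_natr (negPf ninc) opprB; case: ifP => // /(ltn_label L).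
by rewrite !eltK; lia.
Qed.

Lemma free_drop_tau_far I L i j : (0 < i < #|P|)%N -> (0 < j < #|P|)%N ->
  (i.+1 < j)%N || (j.+1 < i)%N -> free_drop I (tau P j L) i = free_drop I L i.
Proof.
move=> iP jP ij; have [ltj|ninc] := boolP (elt L j < elt L j.+1)%O.
  by rewrite tau_id.
rewrite /free_drop /drop !elt_tau //; try by lia.
by rewrite !swap_nat_id //; lia.
Qed.

(** Distinct indices of equal parity differ by at least 2, so only the occurrences of [i] in [s] act
    on the positions [i] and [i.+1]. *)
Lemma free_drop_prod I L i (s : seq nat) : (0 < i < #|P|)%N ->
    (forall j, j \in s -> (0 < j < #|P|)%N /\ odd j = odd i) ->
  free_drop I ((\prod_(j <- s) tau P j)%g L) i =
  (-1) ^+ count_mem i s * free_drop I L i.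
Proof.
move=> iP; elim: s L => [|j s IHs] L js.
  by rewrite big_nil perm1 mul1r.
rewrite big_cons permM IHs => [|k ks]; last by apply: js; rewrite inE ks orbT.
have [jP oj] := js j (mem_head j s); rewrite /= exprD -mulrA mulrCA.
congr (_ * _); have [->|nji] := eqVneq j i.
  by rewrite free_drop_tau // mulN1r.
by rewrite mul1r free_drop_tau_far //; lia.
Qed.

(** The index [i] occurs exactly once in the product; [b] lets one statement serve both [tau_odd]
    and [tau_even]. *)
Lemma free_drop_parity I L i b : (0 < i < #|P|)%N -> odd i = b ->
  free_drop I ((\prod_(1 <= j < #|P| | odd j == b) tau P j)%g L) i =
  - free_drop I L i.
Proof.
move=> iP oi; rewrite -big_filter free_drop_prod // => [|j]; last first.
  by rewrite mem_filter mem_index_iota oi => /andP[/eqP -> ->].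
rewrite count_uniq_mem ?filter_uniq ?iota_uniq // mem_filter mem_index_iota.
by rewrite iP oi eqxx mulN1r.
Qed.

(** Reindexing along [s] shows that the sum equals its own opposite. *)
Lemma sum_opp_perm (T : finType) (s : {perm T}) (O : {set T}) (f : T -> int) :
    (forall x, (s x \in O) = (x \in O)) -> (forall x, f (s x) = - f x) ->
  \sum_(x in O) f x = 0.
Proof.
move=> sO fs; have: \sum_(x in O) f x = - \sum_(x in O) f x; last by lia.
rewrite {1}(reindex_inj (@perm_inj _ s)) -sumrN.
by apply: eq_big => x; rewrite ?sO // => _; rewrite fs.
Qed.

Lemma card_des I L : order_ideal I -> I <> set0 -> I <> [set: P] ->
  #|des I L|%:R = 1 - \sum_(1 <= i < #|P|) free_drop I L i.
Proof.
move=> idI In0 InT.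
have bI : \bot%O \in I.
  by have /set0Pn[p pI] := introN eqP In0; apply: idI pI; apply: le0x.
have tI : \top%O \notin I.
  apply/negP => tI; apply: InT; apply/setP => p.
  by rewrite inE; apply: idI tI; apply: lex1.
have P_gt0 : (0 < #|P|)%N by apply/card_gt0P; exists \bot%O.
pose c i : bool := [&& elt L i \in I, elt L i.+1 \notin I
                     & (elt L i < elt L i.+1)%O].
have desE p : (p \in des I L) = (label L p < #|P|)%N && c (label L p).
  rewrite inE /c labelK; apply/andP/and4P => [[pI /existsP[q]]|].
    case/and3P=> /eqP Lq qI; rewrite (covers_label Lq) => pq.
    rewrite -Lq labelK; split=> //.
    by have := label_bounds L q; rewrite Lq.
  case=> Lp pI qI pq; split=> //; apply/existsP; exists (elt L (label L p).+1).
  have Lq : label L (elt L (label L p).+1) = (label L p).+1 by rewrite eltK.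
  by rewrite Lq eqxx qI (covers_label Lq).
have -> : #|des I L|%:R = \sum_(1 <= i < #|P|) (c i)%:R :> int.
  (* Labels run up to [#|P|], the sum only to [#|P| - 1]: [G] adds a zero term at [#|P|], so that
     the sum can be reindexed along [L]. *)
  pose G i := ((i < #|P|)%N && c i)%:R : int.
  rewrite -sum1_card natr_sum big_mkcond /=.
  rewrite (eq_bigr (fun p => G (L p).+1)) => [|p _]; last first.
    by rewrite /G desE; case: ifP.
  have -> : \sum_(1 <= i < #|P|) (c i)%:R = \sum_(1 <= i < #|P|.+1) G i.
    rewrite big_nat_recr //= [G #|P|]/G ltnn addr0.
    by apply: eq_big_nat => i /andP[_ iP]; rewrite /G iP.
  rewrite big_add1 big_mkord (reindex L) //=.
  exact: onW_bij (linext_bij L).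
apply/eqP; rewrite eq_sym subr_eq -big_split /=; apply/eqP.
transitivity (- ((elt L #|P| \in I)%:R - (elt L 1 \in I)%:R) : int).
  by rewrite elt_card elt1 bI (negPf tI).
rewrite -(telescope_sumr (fun i => (elt L i \in I)%:R)) //.
rewrite -sumrN; apply: eq_bigr => i _; rewrite opprB /free_drop /drop /c.
(* At a free index [c i] is false. Otherwise [elt L i.+1 \in I] forces [elt L i \in I], so the drop
   is never -1 and equals [c i]. *)
case: ifP => [/ltW le_i|_]; last by rewrite !andbF add0r.
have := idI _ _ le_i; rewrite addr0 andbT.
by case: (elt L i.+1 \in I) => [->|_]; case: (elt L i \in I).
Qed.

Lemma sum_card_des I (O : {set linext P}) :
    order_ideal I -> I <> set0 -> I <> [set: P] ->
    (forall L, (tau_odd P L \in O) = (L \in O)) ->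
    (forall L, (tau_even P L \in O) = (L \in O)) ->
  (\sum_(L in O) #|des I L| = #|O|)%N.
Proof.
move=> idI In0 InT oO eO; apply/eqP; rewrite -(eqr_nat int) natr_sum.
rewrite (eq_bigr _ (fun L _ => card_des L idI In0 InT)) sumrB exchange_big /=.
(* With the sums exchanged, each position [i] is treated separately, using whichever of the two
   products contains [tau i]. *)
rewrite [X in _ - X]big_nat [X in _ - X]big1 => [|i iP].
  by rewrite subr0 -sum1_card natr_sum.
case oi: (odd i).
  apply: (sum_opp_perm oO) => L; rewrite -(free_drop_parity _ _ iP oi).
  by rewrite (eq_bigl _ _ (fun j => eqb_id (odd j))).
apply: (sum_opp_perm eO) => L; rewrite -(free_drop_parity _ _ iP oi).
by rewrite (eq_bigl _ _ (fun j => eqbF_neg (odd j))).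
Qed.

(** * Passage to orbits *)

Lemma orbit_tau_group (s : {perm linext P}) L : s \in tau_group P ->
  orbit 'P (tau_group P) (s L) = orbit 'P (tau_group P) L.
Proof. by move=> sG; apply/orbit_eqP/orbitP; exists s. Qed.

Lemma tau_odd_group : tau_odd P \in tau_group P.
Proof. by rewrite mem_gen // !inE eqxx. Qed.

Lemma tau_even_group : tau_even P \in tau_group P.
Proof. by rewrite mem_gen // !inE eqxx orbT. Qed.

End Gyration.

Theorem theorem5p7 (d : Order.disp_t) (P : finTBPOrderType d) (I : {set P})
    (ideal_I : order_ideal I) (I_neq0 : I <> set0) (I_neqT : I <> [set: P]) :
  (exists Phi : {pL : P * linext P | pL.1 \in des I pL.2} -> linext P,
      bijective Phi /\
      forall x : {pL : P * linext P | pL.1 \in des I pL.2},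
        Phi x \in orbit 'P (tau_group P) (val x).2)
  /\ homomesic 'P (tau_group P) (fun L : linext P => (#|des I L|%:R)%R) 1%R.
Proof.
set G := tau_group P.
(* Here [c] is any set of linear extensions; if it is not an orbit, both sides are 0. This matches
   the fibrewise hypothesis of [fiber_bijection]. *)
have sum_fiber c :
    \sum_(L in [set L | orbit 'P G L == c]) #|des I L|
      = #|[set L | orbit 'P G L == c]|.
  apply: sum_card_des => // L;
  by rewrite !inE orbit_tau_group ?tau_odd_group ?tau_even_group.
split.
  pose f (x : {pL : P * linext P | pL.1 \in des I pL.2}) :=
    orbit 'P G (val x).2.
  have [|Phi [bijPhi gPhi]] := @fiber_bijection _ _ _ f (orbit 'P G).
    move=> c; have := sum_fiber c; rewrite cardsE => <-.
    (* The sum of the [#|des I L|] is turned into a count of pairs [(p, L)], that is, of the fibre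
       of [f] over [c]. *)
    under [RHS]eq_bigr do rewrite -sum1_card.
    rewrite (exchange_big_dep xpredT) //= pair_big_dep /=.
    rewrite -(card_imset _ val_inj) -sum1_card; apply: eq_bigl => pL.
    rewrite inE; apply/imsetP/andP => [[x fx ->]|[cL pLdes]].
      by split; [exact: fx | exact: (valP x)].
    by exists (exist _ pL pLdes).
  by exists Phi; split=> // x; rewrite -[orbit _ _ _]gPhi orbit_refl.
move=> L; rewrite -natr_sum.
(* An orbit is the fibre of the orbit map over itself, so [sum_fiber] applies. *)
have -> : orbit 'P G L = [set L' | orbit 'P G L' == orbit 'P G L].
  by apply/setP => L'; rewrite inE; apply/idP/eqP => /orbit_eqP.
rewrite sum_fiber divff // pnatr_eq0 -lt0n; apply/card_gt0P.
by exists L; rewrite inE.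
Qed.
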